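(* Let $\mathbb{C}$ be a regular category which admits binary coproducts, and let $S$ be an object of $\mathbb{C}$. Write $2S=S+S$ with coproduct injections $\iota_1,\iota_2:S\to 2S$, and $3S=S+S+S$. Let $\varphi:3S\to 2S\times 2S$ be the morphism whose restrictions along the first, second and third coproduct injections $S\to 3S$ are $(\iota_1,\iota_2)$, $(\iota_2,\iota_2)$ and $(\iota_2,\iota_1)$ respectively, and let $\varphi=r'\circ e$ be its (regular epimorphism, monomorphism)-factorization, with $e:3S\to R'$ and $r'=(r_1',r_2'):R'\to 2S\times 2S$, so that $(R',r_1',r_2')$ is an internal relation from $2S$ to $2S$. Then the following are equivalent: (a) $S$ is a Mal'tsev object of $\mathbb{C}$; (b) $\iota_1R'\iota_1$, i.e. there is a morphism $h:S\to R'$ with $r_1'h=\iota_1$ and $r_2'h=\iota_1$.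
   Context: An internal relation from $X$ to $Y$ in a category $\mathbb{C}$ is a triple $(R,r_1,r_2)$ where $r_1:R\to X$ and $r_2:R\to Y$ are jointly monomorphic morphisms of $\mathbb{C}$. For an object $S$ and morphisms $f:S\to X$, $g:S\to Y$, write $fRg$ if there is $h:S\to R$ with $r_1h=f$ and $r_2h=g$. An object $S$ of $\mathbb{C}$ is a Mal'tsev object if for all objects $X,Y$, every internal relation $(R,r_1,r_2)$ from $X$ to $Y$ and all morphisms $x_1,x_2:S\to X$ and $y_1,y_2:S\to Y$: if $x_1Ry_2$, $x_2Ry_2$ and $x_2Ry_1$, then $x_1Ry_1$. *)

(* Defs.v *)
Set Implicit Arguments.
Unset Strict Implicit.
Unset Printing Implicit Defensive.

Declare Scope cat_scope.
Delimit Scope cat_scope with cat.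

Record category : Type := Category {
  obj :> Type;
  hom : obj -> obj -> Type;
  idm : forall A, hom A A;
  comp : forall A B D, hom B D -> hom A B -> hom A D;
  comp1m : forall A B (f : hom A B), comp (idm B) f = f;
  compm1 : forall A B (f : hom A B), comp f (idm A) = f;
  compA : forall A B D E (h : hom D E) (g : hom B D) (f : hom A B),
    comp h (comp g f) = comp (comp h g) f
}.

Arguments hom {c} A B.
Arguments idm {c} A.
Arguments comp {c A B D} g f.

Notation "g ∘ f" := (comp g f) (at level 40, left associativity) : cat_scope.
Open Scope cat_scope.

Section Notions.
Variable C : category.
Implicit Types A B D P Q R S T X Y Z : C.

Definition mono A B (m : hom A B) : Prop :=
  forall Z (u v : hom Z A), m ∘ u = m ∘ v -> u = v.

Definition jointly_mono R X Y (r1 : hom R X) (r2 : hom R Y) : Prop :=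
  forall Z (u v : hom Z R), r1 ∘ u = r1 ∘ v -> r2 ∘ u = r2 ∘ v -> u = v.

Definition is_terminal T : Prop :=
  forall Z, exists! _ : hom Z T, True.

Definition is_product X Y P (p1 : hom P X) (p2 : hom P Y) : Prop :=
  forall Z (f : hom Z X) (g : hom Z Y),
    exists! h : hom Z P, p1 ∘ h = f /\ p2 ∘ h = g.

Definition is_coproduct X Y Q (i1 : hom X Q) (i2 : hom Y Q) : Prop :=
  forall Z (f : hom X Z) (g : hom Y Z),
    exists! h : hom Q Z, h ∘ i1 = f /\ h ∘ i2 = g.

Definition is_coproduct3 X Y Z Q
    (i1 : hom X Q) (i2 : hom Y Q) (i3 : hom Z Q) : Prop :=
  forall T (f : hom X T) (g : hom Y T) (k : hom Z T),
    exists! h : hom Q T, h ∘ i1 = f /\ h ∘ i2 = g /\ h ∘ i3 = k.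

Definition is_pullback X Y Z (f : hom X Z) (g : hom Y Z)
    P (p1 : hom P X) (p2 : hom P Y) : Prop :=
  f ∘ p1 = g ∘ p2 /\
  forall T (u : hom T X) (v : hom T Y), f ∘ u = g ∘ v ->
    exists! h : hom T P, p1 ∘ h = u /\ p2 ∘ h = v.

Definition is_coequalizer A B (u v : hom A B) Q (q : hom B Q) : Prop :=
  q ∘ u = q ∘ v /\
  forall T (f : hom B T), f ∘ u = f ∘ v -> exists! h : hom Q T, h ∘ q = f.

Definition regular_epi B Q (q : hom B Q) : Prop :=
  exists A (u v : hom A B), is_coequalizer u v q.

(* Terminal object and pullbacks: equivalently, all finite limits. *)
Definition finitely_complete : Prop :=
  (exists T, is_terminal T) /\
  (forall X Y Z (f : hom X Z) (g : hom Y Z),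
     exists P (p1 : hom P X) (p2 : hom P Y), is_pullback f g p1 p2).

Definition kernel_pairs_have_coequalizers : Prop :=
  forall X Y (f : hom X Y) K (k1 k2 : hom K X), is_pullback f f k1 k2 ->
    exists Q (q : hom X Q), is_coequalizer k1 k2 q.

Definition regular_epis_pullback_stable : Prop :=
  forall X Y Z (q : hom X Z) (g : hom Y Z) P (p1 : hom P X) (p2 : hom P Y),
    is_pullback q g p1 p2 -> regular_epi q -> regular_epi p2.

Definition regular_category : Prop :=
  finitely_complete /\ kernel_pairs_have_coequalizers /\
  regular_epis_pullback_stable.

Definition has_binary_coproducts : Prop :=
  forall X Y, exists Q (i1 : hom X Q) (i2 : hom Y Q), is_coproduct i1 i2.

(* [related r1 r2 f g] is the relation "f R g" for R = (R, r1, r2). *)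
Definition related R X Y (r1 : hom R X) (r2 : hom R Y)
    S (f : hom S X) (g : hom S Y) : Prop :=
  exists h : hom S R, r1 ∘ h = f /\ r2 ∘ h = g.

Definition maltsev_object S : Prop :=
  forall X Y R (r1 : hom R X) (r2 : hom R Y), jointly_mono r1 r2 ->
  forall (x1 x2 : hom S X) (y1 y2 : hom S Y),
    related r1 r2 x1 y2 -> related r1 r2 x2 y2 -> related r1 r2 x2 y1 ->
    related r1 r2 x1 y1.

(* [is_pairing p1 p2 a b f]: f is the morphism (a, b) into the product
   with projections p1, p2. *)
Definition is_pairing X Y P (p1 : hom P X) (p2 : hom P Y)
    Z (a : hom Z X) (b : hom Z Y) (f : hom Z P) : Prop :=
  p1 ∘ f = a /\ p2 ∘ f = b.

End Notions.

(* Main.v *)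
(** (a) => (b): apply the Mal'tsev property to R' itself, since the components
    of e witness i1 R' i2, i2 R' i2 and i2 R' i1.
    (b) => (a): the three witnesses of the hypotheses on R assemble into
    t : 3S -> R lying over [x1,x2] x [y1,y2] : 2S x 2S -> X x Y. As
    (r1, r2) is jointly monic and e is a strong epimorphism, t factors as k ∘ e,
    so k : R' -> R carries the witness of i1 R' i1 to one of x1 R y1. *)

Require Import Defs.

Set Implicit Arguments.
Unset Strict Implicit.
Unset Printing Implicit Defensive.

Section EpisAndMonos.
Variable C : category.
Implicit Types A B P Q R S X Y Z : C.

Lemma regular_epi_epi B Q (q : hom B Q) Z (f g : hom Q Z) :
  regular_epi q -> f ∘ q = g ∘ q -> f = g.
Proof.
  intros (A & u & v & Huv & Hq) Hfg.
  destruct (Hq Z (f ∘ q)) as (h & _ & Hh).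
  - now rewrite <- !compA, Huv.
  - transitivity h; [symmetry|]; now apply Hh.
Qed.

Lemma coproduct3_ext A B D Q Z (j1 : hom A Q) (j2 : hom B Q) (j3 : hom D Q)
    (f g : hom Q Z) :
  is_coproduct3 j1 j2 j3 ->
  f ∘ j1 = g ∘ j1 -> f ∘ j2 = g ∘ j2 -> f ∘ j3 = g ∘ j3 -> f = g.
Proof.
  intros HQ H1 H2 H3.
  destruct (HQ Z (g ∘ j1) (g ∘ j2) (g ∘ j3)) as (h & _ & Hh).
  transitivity h; [symmetry|]; now apply Hh.
Qed.

Lemma product_mono_jointly_mono X Y P (p1 : hom P X) (p2 : hom P Y)
    R (r : hom R P) :
  is_product p1 p2 -> mono r -> jointly_mono (p1 ∘ r) (p2 ∘ r).
Proof.
  intros HP Hr Z u v H1 H2. apply Hr.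
  destruct (HP Z (p1 ∘ (r ∘ v)) (p2 ∘ (r ∘ v))) as (h & _ & Hh).
  transitivity h; [symmetry|]; apply Hh; now rewrite ?compA.
Qed.

(** Orthogonality of a regular epimorphism to a jointly monic pair, which stands in for a mono from
    [R] to the product of [X] and [Y]. If [e] is the coequalizer of [u] and [v], then [t] also
    coequalizes them, since both components of [t] factor through [e]; the equations for the induced
    [k] follow by cancelling [e]. *)
Lemma regular_epi_lift_jointly_mono B Q (e : hom B Q)
    R X Y (r1 : hom R X) (r2 : hom R Y)
    (t : hom B R) (f : hom Q X) (g : hom Q Y) :
  regular_epi e -> jointly_mono r1 r2 ->
  r1 ∘ t = f ∘ e -> r2 ∘ t = g ∘ e ->
  exists k : hom Q R, r1 ∘ k = f /\ r2 ∘ k = g.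
Proof.
  intros He Hr Hf Hg.
  pose proof He as (A & u & v & Huv & Hcoeq).
  destruct (Hcoeq R t) as (k & Hk & _).
  - apply Hr.
    + now rewrite !compA, Hf, <- !compA, Huv.
    + now rewrite !compA, Hg, <- !compA, Huv.
  - exists k; split; apply (regular_epi_epi He); now rewrite <- compA, Hk.
Qed.

End EpisAndMonos.

Theorem proposition2p3 (C : category)
  (C_regular : regular_category C)
  (C_coproducts : has_binary_coproducts C)
  (S S2 S3 P R' : C)
  (i1 i2 : hom S S2) (S2_coproduct : is_coproduct i1 i2)
  (j1 j2 j3 : hom S S3) (S3_coproduct : is_coproduct3 j1 j2 j3)
  (p1 p2 : hom P S2) (P_product : is_product p1 p2)
  (phi : hom S3 P)
  (phi_j1 : is_pairing p1 p2 i1 i2 (phi ∘ j1))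
  (phi_j2 : is_pairing p1 p2 i2 i2 (phi ∘ j2))
  (phi_j3 : is_pairing p1 p2 i2 i1 (phi ∘ j3))
  (e : hom S3 R') (e_regular_epi : regular_epi e)
  (r' : hom R' P) (r'_mono : mono r')
  (phi_factor : phi = r' ∘ e) :
  maltsev_object S <-> related (p1 ∘ r') (p2 ∘ r') i1 i1.
Proof.
  destruct phi_j1 as [F11 F12], phi_j2 as [F21 F22], phi_j3 as [F31 F32].
  subst phi. rewrite !compA in F11, F12, F21, F22, F31, F32.
  split.
  - intros HS.
    (* The instance x1 = y1 = [i1], x2 = y2 = [i2]: its three premises are the restrictions of [phi]
       to the summands of [S3]. *)
    apply (HS _ _ _ _ _ (product_mono_jointly_mono P_product r'_mono)
             i1 i2 i1 i2).
    + exists (e ∘ j1). now rewrite !compA.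
    + exists (e ∘ j2). now rewrite !compA.
    + exists (e ∘ j3). now rewrite !compA.
  - intros (h & Hh1 & Hh2) X Y R r1 r2 Hr x1 x2 y1 y2
      (h1 & A1 & B1) (h2 & A2 & B2) (h3 & A3 & B3).
    destruct (S2_coproduct _ x1 x2) as (a & (Ha1 & Ha2) & _).
    destruct (S2_coproduct _ y1 y2) as (b & (Hb1 & Hb2) & _).
    destruct (S3_coproduct _ h1 h2 h3) as (t & (Ht1 & Ht2 & Ht3) & _).
    destruct (regular_epi_lift_jointly_mono (t := t) (f := a ∘ (p1 ∘ r'))
                (g := b ∘ (p2 ∘ r')) e_regular_epi Hr)
      as (k & Hk1 & Hk2).
    (* On the three summands, [a] and [b] send the components (i1, i2), (i2, i2), (i2, i1) of [phi]
       to (x1, y2), (x2, y2), (x2, y1), the pairs witnessed by [h1], [h2], [h3]. *)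
    + apply (coproduct3_ext S3_coproduct); rewrite <- compA, <- !(compA a).
      * now rewrite Ht1, F11, Ha1.
      * now rewrite Ht2, F21, Ha2.
      * now rewrite Ht3, F31, Ha2.
    + apply (coproduct3_ext S3_coproduct); rewrite <- compA, <- !(compA b).
      * now rewrite Ht1, F12, Hb2.
      * now rewrite Ht2, F22, Hb2.
      * now rewrite Ht3, F32, Hb1.
    + exists (k ∘ h); split; rewrite compA.
      * now rewrite Hk1, <- compA, Hh1.
      * now rewrite Hk2, <- compA, Hh2.
Qed.
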